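(* Let $n \ge 2$ be a natural number and let $(v_k)_{k\in\mathbb{N}}$ be a sequence of elements of $V=\mathbb{C}^n$. Assume that $$\sum_{k} \frac{1}{\|v_k\|^{2n-2}} < \infty .$$ Then the set $D=\{v_k : k\in\mathbb{N}\}$ is tame, i.e., there exists a biholomorphic map $\phi:\mathbb{C}^n\to\mathbb{C}^n$ such that $$\phi(D)=\mathbb{Z}\times\{0\}^{n-1}.$$
   Context: $\|\cdot\|$ denotes the standard Hermitian (Euclidean) norm on $\mathbb{C}^n$. The sequence is an infinite sequence indexed by $\mathbb{N}$. The term $1/\|v_k\|^{2n-2}$ is understood as $+\infty$ if $v_k=0$, so the hypothesis includes that all $v_k$ are nonzero. $\mathbb{Z}\times\{0\}^{n-1}$ is regarded as a subset of $\mathbb{C}\times\mathbb{C}^{n-1}=\mathbb{C}^n$. A discrete subset $D\subset\mathbb{C}^n$ ($n\ge 2$) is called tame if there is a holomorphic automorphism $\phi$ of $\mathbb{C}^n$ with $\phi(D)=\mathbb{Z}\times\{0\}^{n-1}$. *)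

(* Defs.v *)
From HB Require Import structures.
From mathcomp Require Import all_boot all_order all_algebra.
From mathcomp Require Import complex.
From mathcomp Require Import all_classical all_reals all_analysis.

Set Implicit Arguments.
Unset Strict Implicit.
Unset Printing Implicit Defensive.

Import Order.TTheory GRing.Theory Num.Theory.
Import numFieldNormedType.Exports.

Local Open Scope classical_set_scope.
Local Open Scope ring_scope.

(* Packing R[i] as a [numFieldType] is what gives it, and the matrices over it,
   their topology and norm. That library norm on row vectors is the sup norm; it
   is used below only through differentiability, which does not depend on the
   choice of a norm on C^n. *)
Definition Cfield (R : realType) : numFieldType := R[i].

Notation Cn R n := 'rV[Cfield R]_n.

Definition hnorm (R : realType) (n : nat) (v : Cn R n) : R :=
  Num.sqrt (\sum_(i < n) (complex.Re (v ord0 i) ^+ 2 + complex.Im (v ord0 i) ^+ 2)).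

(* [differentiable] is taken over the scalar field R[i], so the differential is
   C-linear. *)
Definition holomorphic (R : realType) (n m : nat) (f : Cn R n -> Cn R m) : Prop :=
  forall z : Cn R n, differentiable f z.

Definition biholomorphic (R : realType) (n : nat) (f : Cn R n -> Cn R n) : Prop :=
  exists g : Cn R n -> Cn R n,
    [/\ cancel f g, cancel g f, holomorphic f & holomorphic g].

Definition Zaxis (R : realType) (n : nat) : set (Cn R n) :=
  [set \row_(j < n) (if j == 0 :> nat then m%:~R else 0) | m in [set: int]].
Arguments Zaxis : clear implicits.

(* No separate discreteness condition on [D]: it follows from the equality,
   since [phi] is a homeomorphism. *)
Definition tame (R : realType) (n : nat) (D : set (Cn R n)) : Prop :=
  exists phi : Cn R n -> Cn R n, biholomorphic phi /\ phi @` D = Zaxis R n.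

(* Main.v *)
Require Import Defs.
From mathcomp Require Import all_boot all_order all_algebra.
From mathcomp Require Import complex ring lra.
From mathcomp Require Import all_classical all_reals all_analysis.
From mathcomp Require Import measurable_realfun.
Import Order.TTheory GRing.Theory Num.Theory.
Import numFieldNormedType.Exports.
Local Open Scope classical_set_scope.
Local Open Scope ring_scope.

Set Implicit Arguments.
Unset Strict Implicit.
Unset Printing Implicit Defensive.

(** Points whose projections along some line tend to infinity can be moved onto
    the integer axis by shears, and the summability hypothesis says that almost
    every direction of projection is good.

    Projection. For [a] in the unit cube, the shear [z_j -= a_j z_0] ([j != 0])
    displays in the coordinates [j != 0] the projection of [C^n] to [C^(n-1)]
    along the line spanned by [(1, a)]. The [a] for which the projection of
    [v_k] has modulus at most [r] fill a set of measure of order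
    [|v_k|^(2 - 2n)], up to finitely many [k]. By Borel-Cantelli, a generic [a]
    has only finitely many such [k], for every [r] ([exists_proper_shear]). The
    Borel-Cantelli argument is run on one real coordinate of [a] at a time, so
    that it only involves Lebesgue measure on the line ([generic_point]).
    Avoiding countably many values moreover makes the projection injective on
    [D].

    Straightening. List [D] as [(p_k)], already sheared as above. The
    projections of the [p_k] are distinct and tend to infinity, so an entire
    function [f] of the coordinates [j != 0] can be prescribed at all of them;
    the shear [z_0 += f] makes the zeroth coordinate of [p_k] equal to the
    [k]-th integer. The integers in turn are distinct and tend to infinity, so
    entire functions of [z_0] interpolate the remaining coordinates, and
    subtracting them puts the points on the axis ([tame_of_proper]).

    Interpolation in several variables is elementary: a product of affine
    functions vanishes at [p_0, .., p_(k-1)] and not at [p_k], and a high power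
    of [z_i / (p_k)_i], where [i] is the largest coordinate of [p_k], makes it
    as small as desired on a polydisc whose radius grows with [p_k]
    ([entire_bump]). The resulting series is holomorphic because its terms are
    controlled together with a candidate gradient and a quadratic remainder
    bound, a package that is stable under sums, products and limits
    ([entire_series], [entire_holomorphic]). *)

(** * Real-valued modulus and limits of complex sequences *)

Section Modulus.
Variable R : realType.
Implicit Types x y : Cfield R.

(** The norm of the field is itself complex-valued, in a partial order; its
    real part makes the estimates below linear arithmetic over [R]. *)
Definition cmod x : R := complex.Re `|x|.

Lemma cmodE x : `|x| = (cmod x)%:C%C.
Proof. by rewrite /cmod normc_def. Qed.

Lemma cmod_ge0 x : 0 <= cmod x.
Proof. by rewrite -(lecR 0) -cmodE; exact: normr_ge0. Qed.

Lemma cmod0 : cmod 0 = 0. Proof. by rewrite /cmod normr0. Qed.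
Lemma cmod1 : cmod 1 = 1. Proof. by rewrite /cmod normr1. Qed.
Lemma cmodN x : cmod (- x) = cmod x. Proof. by rewrite /cmod normrN. Qed.

Lemma cmodM x y : cmod (x * y) = cmod x * cmod y.
Proof. by apply: complexI; rewrite rmorphM /= -!cmodE normrM. Qed.

Lemma cmodV x : cmod x^-1 = (cmod x)^-1.
Proof. by apply: complexI; rewrite fmorphV /= -!cmodE normfV. Qed.

Lemma cmodD x y : cmod (x + y) <= cmod x + cmod y.
Proof. by rewrite -lecR rmorphD /= -!cmodE; exact: ler_normD. Qed.

Lemma cmodB x y : cmod (x - y) <= cmod x + cmod y.
Proof. by rewrite -(cmodN y); exact: cmodD. Qed.

Lemma cmod_eq0 x : (cmod x == 0) = (x == 0).
Proof. by rewrite -(inj_eq (@complexI _)) /= -cmodE normr_eq0. Qed.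

Lemma cmod_real (a : R) : cmod (a%:C%C) = `|a|.
Proof. by rewrite /cmod normc_def /= expr0n addr0 sqrtr_sqr. Qed.

Lemma cmod_Re x : `|complex.Re x| <= cmod x.
Proof. by rewrite -lecR -cmodE; exact: normc_ge_Re. Qed.

Lemma cmod_Im x : `|complex.Im x| <= cmod x.
Proof.
rewrite /cmod normc_def /= -(sqrtr_sqr (complex.Im x)).
by apply: ler_wsqrtr; rewrite lerDr sqr_ge0.
Qed.

Lemma cmod_ReIm x : cmod x <= `|complex.Re x| + `|complex.Im x|.
Proof.
rewrite /cmod normc_def /= -[leRHS]ger0_norm ?addr_ge0// -(sqrtr_sqr (_ + _)).
apply: ler_wsqrtr; rewrite sqrrD !real_normK ?num_real// addrAC lerDl.
by rewrite mulrn_wge0// mulr_ge0.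
Qed.

Definition tends (u : nat -> Cfield R) (s : Cfield R) :=
  forall e, 0 < e -> exists K : nat, forall k, (K <= k)%N -> cmod (u k - s) <= e.

Lemma tends_cst s : tends (fun=> s) s.
Proof. by move=> e e0; exists 0 => k _; rewrite subrr cmod0 ltW. Qed.

Lemma tendsD u v s t : tends u s -> tends v t -> tends (fun k => u k + v k) (s + t).
Proof.
move=> us vt e e0; have e20 : 0 < e / 2 by lra.
have [K HK] := us _ e20; have [L HL] := vt _ e20.
exists (maxn K L) => k; rewrite geq_max => /andP[/HK h1 /HL h2].
by rewrite opprD addrACA; apply: le_trans (cmodD _ _) _; lra.
Qed.

Lemma tendsMr u s c : tends u s -> tends (fun k => u k * c) (s * c).
Proof.
move=> us e e0; have c1 : 0 < cmod c + 1 by have := cmod_ge0 c; lra.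
have [K HK] := us (e / (cmod c + 1)) (divr_gt0 e0 c1).
exists K => k /HK h; rewrite -mulrBl cmodM.
apply: le_trans (_ : e / (cmod c + 1) * (cmod c + 1) <= e); last first.
  by rewrite divfK// gt_eqF.
by apply: ler_pM; rewrite ?cmod_ge0// lerDl.
Qed.

Lemma tendsB u v s t : tends u s -> tends v t -> tends (fun k => u k - v k) (s - t).
Proof.
move=> us vt; apply: tendsD => // e e0; have [K HK] := vt _ e0.
by exists K => k /HK; rewrite -opprD cmodN.
Qed.

Lemma tends_sum (I : finType) (u : nat -> I -> Cfield R) (s : I -> Cfield R) :
  (forall i, tends (u^~ i) (s i)) -> tends (fun k => \sum_i u k i) (\sum_i s i).
Proof.
move=> us; elim: (index_enum I) => [|i r IH].
  rewrite big_nil; under [X in tends X _]funext do rewrite big_nil.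
  exact: tends_cst.
rewrite big_cons; under [X in tends X _]funext do rewrite big_cons.
exact: tendsD.
Qed.

Lemma tends_cmod_le u s B (K : nat) :
  tends u s -> (forall k, (K <= k)%N -> cmod (u k) <= B) -> cmod s <= B.
Proof.
move=> us uB; apply/ler_addgt0Pr => e /us[L HL].
have h1 := HL _ (leq_maxr K L); have h2 := uB _ (leq_maxl K L).
have := cmodB (u (maxn K L)) (u (maxn K L) - s); rewrite opprB addrC subrK.
by move=> /le_trans; apply; rewrite lerD.
Qed.

Lemma tends_unique u s t : tends u s -> tends u t -> s = t.
Proof.
move=> us ut; apply/eqP; rewrite -subr_eq0 -cmod_eq0 eq_le cmod_ge0 andbT.
apply: (tends_cmod_le (K := 0) (tendsB us ut)) => k _.
by rewrite subrr cmod0.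
Qed.

Lemma geo_gt (e : R) : 0 < e -> exists K : nat, forall k, (K <= k)%N -> 2^-1 ^+ k <= e.
Proof.
move=> e0; exists (Num.truncn e^-1).+1 => k kK.
rewrite exprVn -(invrK e) lef_pV2 ?posrE ?exprn_gt0 ?invr_gt0//.
have /ltW h : e^-1 < (Num.truncn e^-1).+1%:R by rewrite truncnS_gt.
apply: le_trans h _; apply: le_trans (_ : k%:R <= _); first by rewrite ler_nat.
by rewrite -natrX ler_nat ltnW// ltn_expl.
Qed.

(** The sequences [a k -/+ 2 * 2^-k] are monotone and squeeze the limit, which
    is the supremum of the lower one. *)
Lemma real_geometric_limit (a : nat -> R) :
  (forall k, `|a k.+1 - a k| <= 2^-1 ^+ k) ->
  exists s, forall k, `|a k - s| <= 2 * 2^-1 ^+ k.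
Proof.
move=> ha; pose lo k := a k - 2 * 2^-1 ^+ k; pose hi k := a k + 2 * 2^-1 ^+ k.
have step k : lo k <= lo k.+1 /\ hi k.+1 <= hi k.
  have := ha k; rewrite /lo /hi exprS ler_norml => /andP[h1 h2].
  by split; lra.
have lo_mono : {homo lo : x y / (x <= y)%N >-> x <= y}.
  by apply: homo_leq => [//|y x z|k]; [exact: le_trans|case: (step k)].
have hi_mono : {homo hi : x y / (x <= y)%N >-> y <= x}.
  by apply: homo_leq => [//|y x z h1 h2|k]; [exact: le_trans h2 h1|case: (step k)].
have lohi k l : lo k <= hi l.
  apply: le_trans (lo_mono _ _ (leq_maxl k l)) _.
  apply: le_trans (hi_mono _ _ (leq_maxr k l)).
  rewrite /lo /hi; have : 0 <= 2^-1 ^+ maxn k l :> R by apply: exprn_ge0; lra.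
  lra.
exists (sup (range lo)) => k.
have h1 : lo k <= sup (range lo).
  apply: ub_le_sup; last by exists k.
  by exists (hi 0%N) => _ [l _ <-].
have h2 : sup (range lo) <= hi k.
  by apply: ge_sup; [exists (lo 0%N); exists 0%N|move=> _ [l _ <-]].
by rewrite ler_norml; move: h1 h2; rewrite /lo /hi => h1 h2; apply/andP; split; lra.
Qed.

(** Completeness is only needed for series dominated by [2^-k], where it reduces
    to the real and imaginary parts; the index [K] allows for finitely many
    terms that are not yet dominated. *)
Lemma geometric_limit (u : nat -> Cfield R) (K : nat) :
  (forall k, (K <= k)%N -> cmod (u k.+1 - u k) <= 2^-1 ^+ k) -> exists s, tends u s.
Proof.
move=> hu.
have shift k : cmod (u (K + k)%N.+1 - u (K + k)%N) <= 2^-1 ^+ k.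
  apply: le_trans (hu _ (leq_addr _ _)) _.
  by rewrite exprD ler_piMl ?exprn_ge0 ?exprn_ile1//; lra.
have [k|a Ha] := @real_geometric_limit (fun k => complex.Re (u (K + k)%N)).
  rewrite addnS; apply: le_trans (shift k).
  by apply: le_trans (cmod_Re _); rewrite !raddfB.
have [k|b Hb] := @real_geometric_limit (fun k => complex.Im (u (K + k)%N)).
  rewrite addnS; apply: le_trans (shift k).
  by apply: le_trans (cmod_Im _); rewrite !raddfB.
exists (a +i* b)%C => e e0.
have [L HL] := @geo_gt (e / 4) ltac:(lra).
exists (K + L)%N => k Kk; have -> : k = (K + (k - K))%N.
  by rewrite subnKC//; apply: leq_trans Kk; rewrite leq_addr.
have {}HL : 2^-1 ^+ (k - K) <= e / 4 by apply: HL; rewrite leq_subRL// (leq_trans (leq_addr L K)).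
apply: le_trans (cmod_ReIm _) _; rewrite !raddfB /=.
by have := Ha (k - K)%N; have := Hb (k - K)%N; lra.
Qed.

End Modulus.

(** * Entire functions through quadratic bounds *)

Section QuadraticBounds.
Variables (R : realType) (n : nat).
Local Notation C := (Cfield R).
Local Notation fn := (Cn R n -> C).
Local Notation gr := (Cn R n -> 'I_n -> C).
Implicit Types (f g : fn) (df dg : gr) (z h : Cn R n).

Definition in_polydisc (r : R) z := forall i, cmod (z ord0 i) <= r.

Definition lin df z h : C := \sum_i df z i * h ord0 i.

(** The one constant [M] bounds the value, the increments, the candidate
    differential and the second-order remainder of [f]. Stating all four as
    inequalities between finitely many values makes them pass to pointwise
    limits, and thus replaces Cauchy estimates. *)
Record qbound (r M : R) f df : Prop := QBound {
  qb_ge0 : 0 <= M;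
  qb_val : forall z, in_polydisc r z -> cmod (f z) <= M;
  qb_lip : forall z h e, 0 <= e -> in_polydisc r z -> in_polydisc r (z + h) ->
    in_polydisc e h -> cmod (f (z + h) - f z) <= M * e;
  qb_lin : forall z h e, 0 <= e -> in_polydisc r z -> in_polydisc r (z + h) ->
    in_polydisc e h -> cmod (lin df z h) <= M * e;
  qb_quad : forall z h e, 0 <= e -> in_polydisc r z -> in_polydisc r (z + h) ->
    in_polydisc e h -> cmod (f (z + h) - f z - lin df z h) <= M * e ^+ 2 }.

Definition entire f df := forall r, exists M, qbound r M f df.

Lemma qbound_le r r' M M' f df :
  r' <= r -> M <= M' -> qbound r M f df -> qbound r' M' f df.
Proof.
move=> rr MM [M0 h1 h2 h3 h4].
have sub z : in_polydisc r' z -> in_polydisc r z by move=> hz i; apply: le_trans (hz i) rr.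
split=> [|z /sub /h1|z h e e0 /sub hz /sub hzh hh|z h e e0 /sub hz /sub hzh hh
  |z h e e0 /sub hz /sub hzh hh].
- exact: le_trans MM.
- by move=> /le_trans; apply.
- by apply: le_trans (h2 _ _ _ e0 hz hzh hh) _; rewrite ler_wpM2r.
- by apply: le_trans (h3 _ _ _ e0 hz hzh hh) _; rewrite ler_wpM2r.
- by apply: le_trans (h4 _ _ _ e0 hz hzh hh) _; rewrite ler_wpM2r// exprn_ge0.
Qed.

Lemma qbound_cst r c : qbound r (cmod c) (fun=> c) (fun _ _ => 0).
Proof.
have lin0 z h : lin (fun _ _ => 0) z h = 0 by rewrite /lin big1// => i _; rewrite mul0r.
split=> [|//|z h e e0 _ _ _|z h e e0 _ _ _|z h e e0 _ _ _].
- exact: cmod_ge0.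
- by rewrite subrr cmod0 mulr_ge0 ?cmod_ge0.
- by rewrite lin0 cmod0 mulr_ge0 ?cmod_ge0.
- by rewrite lin0 subr0 subrr cmod0 mulr_ge0 ?cmod_ge0// exprn_ge0.
Qed.

Lemma qboundD r M N f df g dg : qbound r M f df -> qbound r N g dg ->
  qbound r (M + N) (fun z => f z + g z) (fun z i => df z i + dg z i).
Proof.
move=> [M0 f1 f2 f3 f4] [N0 g1 g2 g3 g4].
have linD z h : lin (fun z i => df z i + dg z i) z h = lin df z h + lin dg z h.
  by rewrite /lin -big_split; apply: eq_bigr => i _; rewrite mulrDl.
split=> [|z hz|z h e e0 hz hzh hh|z h e e0 hz hzh hh|z h e e0 hz hzh hh] /=.
- exact: addr_ge0.
- by apply: le_trans (cmodD _ _) _; rewrite lerD ?f1 ?g1.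
- rewrite opprD addrACA mulrDl; apply: le_trans (cmodD _ _) _.
  by rewrite lerD ?f2 ?g2.
- by rewrite linD mulrDl; apply: le_trans (cmodD _ _) _; rewrite lerD ?f3 ?g3.
- have -> : f (z + h) + g (z + h) - (f z + g z) - lin (fun z i => df z i + dg z i) z h
      = (f (z + h) - f z - lin df z h) + (g (z + h) - g z - lin dg z h).
    by rewrite linD; ring.
  by rewrite mulrDl; apply: le_trans (cmodD _ _) _; rewrite lerD ?f4 ?g4.
Qed.

(** Writing [Δ] for the increment along [h], the quadratic remainder of a
    product is [(Δf - df h) g(z+h) + (df h) Δg + f(z) (Δg - dg h)]; each of the
    three terms is at most [M N e^2]. *)
Lemma qboundM r M N f df g dg : qbound r M f df -> qbound r N g dg ->
  qbound r (3 * M * N) (fun z => f z * g z) (fun z i => f z * dg z i + g z * df z i).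
Proof.
move=> [M0 f1 f2 f3 f4] [N0 g1 g2 g3 g4].
have MN0 : 0 <= M * N by exact: mulr_ge0.
have bnd (x y : C) (a b : R) : cmod x <= a -> cmod y <= b -> cmod (x * y) <= a * b.
  by move=> xa yb; rewrite cmodM ler_pM ?cmod_ge0.
have linM z h : lin (fun z i => f z * dg z i + g z * df z i) z h =
    f z * lin dg z h + g z * lin df z h.
  rewrite /lin !mulr_sumr -big_split; apply: eq_bigr => i _ /=; ring.
split=> [|z hz|z h e e0 hz hzh hh|z h e e0 hz hzh hh|z h e e0 hz hzh hh] /=.
- by rewrite -mulrA mulr_ge0.
- by apply: le_trans (bnd _ _ _ _ (f1 _ hz) (g1 _ hz)) _; lra.
- have -> : f (z + h) * g (z + h) - f z * g z =
    (f (z + h) - f z) * g (z + h) + f z * (g (z + h) - g z) by ring.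
  apply: le_trans (cmodD _ _) _.
  have := bnd _ _ _ _ (f2 _ _ _ e0 hz hzh hh) (g1 _ hzh).
  have := bnd _ _ _ _ (f1 _ hz) (g2 _ _ _ e0 hz hzh hh).
  have : 0 <= M * N * e by exact: mulr_ge0.
  lra.
- rewrite linM; apply: le_trans (cmodD _ _) _.
  have := bnd _ _ _ _ (g1 _ hz) (f3 _ _ _ e0 hz hzh hh).
  have := bnd _ _ _ _ (f1 _ hz) (g3 _ _ _ e0 hz hzh hh).
  have : 0 <= M * N * e by exact: mulr_ge0.
  lra.
- rewrite linM.
  have -> : f (z + h) * g (z + h) - f z * g z - (f z * lin dg z h + g z * lin df z h) =
    (f (z + h) - f z - lin df z h) * g (z + h) + lin df z h * (g (z + h) - g z)
     + f z * (g (z + h) - g z - lin dg z h) by ring.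
  apply: le_trans (cmodD _ _) _.
  have := cmodD ((f (z + h) - f z - lin df z h) * g (z + h)) (lin df z h * (g (z + h) - g z)).
  have := bnd _ _ _ _ (f4 _ _ _ e0 hz hzh hh) (g1 _ hzh).
  have := bnd _ _ _ _ (f3 _ _ _ e0 hz hzh hh) (g2 _ _ _ e0 hz hzh hh).
  have := bnd _ _ _ _ (f1 _ hz) (g4 _ _ _ e0 hz hzh hh).
  lra.
Qed.

Lemma qbound_coord r M c i : 0 <= M -> cmod c <= M -> cmod c * r <= M ->
  qbound r M (fun z => c * z ord0 i) (fun _ j => if j == i then c else 0).
Proof.
move=> M0 cM crM.
have linE z h : lin (fun _ j => if j == i then c else 0) z h = c * h ord0 i.
  rewrite /lin (bigD1 i)//= eqxx big1 ?addr0// => j /negPf ->; exact: mul0r.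
have lip h e : 0 <= e -> in_polydisc e h -> cmod (c * h ord0 i) <= M * e.
  by move=> e0 hh; rewrite cmodM ler_pM ?cmod_ge0.
split=> [//|z hz|z h e e0 hz hzh hh|z h e e0 hz hzh hh|z h e e0 hz hzh hh] /=.
- by rewrite cmodM; apply: le_trans crM; rewrite ler_wpM2l ?cmod_ge0.
- by rewrite mxE -mulrBr addrAC subrr add0r lip.
- by rewrite linE lip.
- rewrite linE mxE -mulrBr addrAC subrr add0r subrr cmod0.
  by rewrite mulr_ge0// exprn_ge0.
Qed.

Lemma entire_cst c : entire (fun=> c) (fun _ _ => 0).
Proof. by move=> r; exists (cmod c); exact: qbound_cst. Qed.

Lemma entireD f df g dg : entire f df -> entire g dg ->
  entire (fun z => f z + g z) (fun z i => df z i + dg z i).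
Proof.
by move=> hf hg r; have [M ?] := hf r; have [N ?] := hg r; exists (M + N); exact: qboundD.
Qed.

Lemma entireM f df g dg : entire f df -> entire g dg ->
  entire (fun z => f z * g z) (fun z i => f z * dg z i + g z * df z i).
Proof.
by move=> hf hg r; have [M ?] := hf r; have [N ?] := hg r; exists (3 * M * N); exact: qboundM.
Qed.

Lemma entire_coord c i :
  entire (fun z => c * z ord0 i) (fun _ j => if j == i then c else 0).
Proof.
move=> r; exists (cmod c + cmod c * `|r|).
have h1 := cmod_ge0 c; have h2 : 0 <= cmod c * `|r| by rewrite mulr_ge0.
apply: qbound_coord; [exact: addr_ge0|by rewrite lerDl|].
have : cmod c * r <= cmod c * `|r| by rewrite ler_wpM2l// ler_norm.
lra.
Qed.

Lemma qbound_exp r M f df : entire f df -> qbound r M f df -> forall N : nat,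
  exists d, entire (fun z => f z ^+ N) d /\ qbound r ((3 * M) ^+ N) (fun z => f z ^+ N) d.
Proof.
move=> ef hf; elim=> [|N [d [ed hd]]].
  exists (fun _ _ => 0); split; first exact: (entire_cst 1).
  by rewrite expr0 -cmod1; exact: qbound_cst.
exists (fun z i => f z * d z i + f z ^+ N * df z i); split.
  by under eq_fun do rewrite exprS; exact: entireM.
under eq_fun do rewrite exprS; rewrite exprS.
exact: qboundM.
Qed.

(** The derivative in direction [i] is recovered from [qb_lin] with increment
    the [i]-th unit vector, at the price of enlarging the polydisc by one. *)
Lemma qbound_grad r M f df z i :
  qbound (r + 1) M f df -> in_polydisc r z -> cmod (df z i) <= M.
Proof.
move=> hf hz; pose h : Cn R n := \row_j (if j == i then 1 else 0).
have linE : lin df z h = df z i.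
  rewrite /lin (bigD1 i)//= mxE eqxx mulr1 big1 ?addr0// => j /negPf ji.
  by rewrite mxE ji mulr0.
have hh : in_polydisc 1 h by move=> j; rewrite mxE; case: eqP; rewrite ?cmod1 ?cmod0.
rewrite -linE -[M]mulr1; apply: (qb_lin hf) => // j.
  by apply: le_trans (hz j) _; lra.
by rewrite mxE; apply: le_trans (cmodD _ _) _; rewrite lerD.
Qed.

Lemma qbound_lim r M (K : nat) (F : nat -> fn) (dF : nat -> gr) f df :
  (forall z, tends (F^~ z) (f z)) -> (forall z i, tends (fun k => dF k z i) (df z i)) ->
  (forall k, (K <= k)%N -> qbound r M (F k) (dF k)) -> qbound r M f df.
Proof.
move=> Ff dFf hF; have linE z h : tends (fun k => lin (dF k) z h) (lin df z h).
  by apply: tends_sum => i; exact: tendsMr.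
split=> [|z hz|z h e e0 hz hzh hh|z h e e0 hz hzh hh|z h e e0 hz hzh hh] /=.
- exact: qb_ge0 (hF K (leqnn K)).
- by apply: (tends_cmod_le (K := K) (Ff z)) => k /hF /qb_val; exact.
- by apply: (tends_cmod_le (K := K) (tendsB (Ff _) (Ff _))) => k /hF /qb_lip; exact.
- by apply: (tends_cmod_le (K := K) (linE _ _)) => k /hF /qb_lin; exact.
- apply: (tends_cmod_le (K := K) (tendsB (tendsB (Ff (z + h)) (Ff z)) (linE z h))).
  by move=> k /hF /qb_quad; exact.
Qed.

(** On a fixed polydisc all but finitely many terms of the series are
    dominated by [2^-k], so the partial sums share one quadratic bound there;
    it survives in the limit. *)
Lemma entire_series (T : nat -> fn) (dT : nat -> gr) :
  (forall k, entire (T k) (dT k)) ->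
  (forall r, exists K : nat, forall k, (K <= k)%N -> qbound r (2^-1 ^+ k) (T k) (dT k)) ->
  exists f df, entire f df /\ forall z, tends (fun k => \sum_(j < k) T j z) (f z).
Proof.
move=> eT hT.
pose F k z := \sum_(j < k) T j z; pose dF k z i := \sum_(j < k) dT j z i.
have FS k : F k.+1 = fun z => F k z + T k z.
  by apply/funext => z; rewrite /F big_ord_recr.
have dFS k : dF k.+1 = fun z i => dF k z i + dT k z i.
  by apply/funext => z; apply/funext => i; rewrite /dF big_ord_recr.
have eF k : entire (F k) (dF k).
  elim: k => [|k IH]; last by rewrite FS dFS; exact: entireD.
  have -> : F 0 = fun=> 0 by apply/funext => z; rewrite /F big_ord0.
  have -> : dF 0 = fun _ _ => 0.
    by apply/funext => z; apply/funext => i; rewrite /dF big_ord0.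
  exact: entire_cst.
have polydisc_ex z : exists r, in_polydisc r z.
  exists (\sum_i cmod (z ord0 i)) => i; rewrite (bigD1 i)//= lerDl.
  by apply: sumr_ge0 => j _; exact: cmod_ge0.
have /choice[f hf] : forall z, exists s, tends (F^~ z) s.
  move=> z; have [r hz] := polydisc_ex z; have [K HK] := hT r.
  apply: (geometric_limit (K := K)) => k /HK hk.
  by rewrite FS /= addrC addKr; exact: (qb_val hk).
have /choice[d hd] : forall zi : Cn R n * 'I_n, exists s, tends (fun k => dF k zi.1 zi.2) s.
  move=> [z i]; have [r hz] := polydisc_ex z; have [K HK] := hT (r + 1).
  apply: (geometric_limit (K := K)) => k /HK hk.
  by rewrite dFS /= addrC addKr; exact: (qbound_grad i hk).
exists f, (fun z i => d (z, i)); split=> // r.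
have [K HK] := hT r; have [M HM] := eF K r.
have M0 := qb_ge0 HM.
exists (M + 2); apply: (qbound_lim (K := K) hf (fun z i => hd (z, i))) => k Kk.
have : qbound r (M + 2 * (1 - 2^-1 ^+ k)) (F k) (dF k).
  rewrite -(subnKC Kk); elim: (k - K)%N => [|m IH].
    rewrite addn0; apply: qbound_le HM => //; rewrite lerDl mulr_ge0// subr_ge0.
    by rewrite exprn_ile1//; lra.
  rewrite addnS FS dFS; apply: qbound_le (qboundD IH (HK _ (leq_addr _ _))) => //.
  by rewrite exprS; lra.
apply: qbound_le => //; have : 0 <= 2^-1 ^+ k :> R by rewrite exprn_ge0//; lra.
lra.
Qed.

End QuadraticBounds.

(** * Holomorphic maps and shears *)

Section Holomorphy.
Variable R : realType.
Local Notation C := (Cfield R).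

Lemma ge0_Re (x : C) : 0 <= x -> x = (complex.Re x)%:C%C.
Proof. by move=> x0; rewrite RRe_real// ger0_real. Qed.

Lemma norm_row_le m (x : Cn R m) (B : C) :
  0 <= B -> (`|x| <= B) <-> (forall i, `|x ord0 i| <= B).
Proof.
move=> /nonnegP[{}B]; rewrite [`|x|]mx_normE num_le; split=> [/bigmax_leP[_ h] i|h].
  by have := h (ord0, i) isT; rewrite -num_le.
apply/bigmax_leP; split=> [|[i j] _]; first by rewrite -num_le /= ge0.
by rewrite -num_le /= (ord1 i).
Qed.

Lemma mulmxr_continuous m p (D : 'M[C]_(m, p)) :
  continuous (mulmxr D : {linear Cn R m -> Cn R p}).
Proof.
apply/linear_bounded_continuous/bounded_funP => r.
have [r0|r0] := pselect (0 <= r); last first.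
  by exists 0 => x xr; case: r0; exact: le_trans xr.
exists (\sum_i \sum_j r * `|D i j|) => x xr.
have T0 i j : 0 <= r * `|D i j| by rewrite mulr_ge0.
have {xr}/norm_row_le xr := xr; apply/norm_row_le => [|j].
  by apply: sumr_ge0 => i _; apply: sumr_ge0.
rewrite /= mxE; apply: le_trans (ler_norm_sum _ _ _) _; apply: ler_sum => i _.
rewrite (bigD1 j)//= normrM -[leLHS]addr0 lerD ?ler_wpM2r ?xr//.
exact: sumr_ge0.
Qed.

(** The Jacobian of [F] at [z] collects the gradients, and the quadratic
    remainder bound on a polydisc around [z] is a little-o at scale [|h|]. *)
Lemma entire_holomorphic n m (F : Cn R n -> Cn R m)
    (dF : 'I_m -> Cn R n -> 'I_n -> C) :
  (forall j, entire (fun z => F z ord0 j) (dF j)) -> holomorphic F.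
Proof.
move=> hF z; pose D := \matrix_(i, j) dF j z i.
pose L : {linear Cn R n -> Cn R m} := mulmxr D.
have cL : continuous L by exact: mulmxr_continuous.
have LE h j : L h ord0 j = lin (dF j) z h.
  by rewrite /L /= mxE; apply: eq_bigr => i _; rewrite mxE mulrC.
have dE := @diff_unique _ _ _ F L z cL.
lazymatch type of dE with ?E -> _ => suff expansion : E end.
  by apply/diff_locallyP; rewrite (dE expansion).
pose r := \sum_i cmod (z ord0 i) + 1.
have zr i : cmod (z ord0 i) <= r - 1.
  rewrite /r addrK (bigD1 i)//= lerDl.
  by apply: sumr_ge0 => j _; exact: cmod_ge0.
have /choice[M hM] : forall j, exists M, qbound r M (fun z => F z ord0 j) (dF j).
  by move=> j; exact: hF.
have M0 j := qb_ge0 (hM j).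
pose N := \sum_j M j + 1.
have MN j : M j <= N.
  rewrite /N (bigD1 j)//= -addrA lerDl addr_ge0//.
  by apply: sumr_ge0.
have N0 : 0 < N by rewrite ltr_wpDl// sumr_ge0.
apply/eqaddoP => eps eps0.
have epsE := ge0_Re (ltW eps0).
have e0 : 0 < complex.Re eps by rewrite -ltcR -epsE.
have d0 : 0 < (complex.Re eps / N)%:C%C :> C by rewrite ltcR divr_gt0.
have small (d : C) : 0 < d -> \forall h \near (0 : Cn R n), `|h| <= d.
  by move=> d1; exact: nbhs0_le.
near=> h.
have hE := ge0_Re (normr_ge0 h); set s := complex.Re `|h| in hE.
have s0 : 0 <= s by rewrite -lecR -hE; exact: normr_ge0.
have s1 : s <= 1 by rewrite -lecR -hE; near: h; exact: small.
have se : s <= complex.Re eps / N by rewrite -lecR -hE; near: h; exact: small.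
have hs i : cmod (h ord0 i) <= s.
  rewrite -lecR -cmodE -hE; exact: (norm_row_le h (normr_ge0 h)).1.
apply/norm_row_le => [|j]; first by rewrite mulr_ge0// ltW.
have -> : (F \o shift z - (cst (F z) + L)) h ord0 j =
    F (z + h) ord0 j - F z ord0 j - lin (dF j) z h.
  by rewrite -LE opprD addrA /= !fctE !mxE [h + z]addrC.
rewrite cmodE hE epsE -rmorphM lecR.
apply: le_trans (qb_quad (hM j) s0 _ _ _) _.
- by move=> i; apply: le_trans (zr i) _; lra.
- by move=> i; rewrite mxE; apply: le_trans (cmodD _ _) _; have := zr i; have := hs i; lra.
- exact: hs.
rewrite expr2 mulrA ler_wpM2r//.
apply: le_trans (_ : N * (complex.Re eps / N) <= _).
  by rewrite ler_pM.
by rewrite mulrC divfK// gt_eqF.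
Unshelve. all: by end_near. Qed.

Lemma biholomorphic_comp n (f g : Cn R n -> Cn R n) :
  biholomorphic f -> biholomorphic g -> biholomorphic (g \o f).
Proof.
move=> [f' [ff' f'f hf hf']] [g' [gg' g'g hg hg']].
exists (f' \o g'); split; [exact: can_comp|exact: can_comp| |].
  by move=> z; apply: differentiable_comp.
by move=> z; apply: differentiable_comp.
Qed.

Definition shear n (T : pred 'I_n) (G : 'I_n -> Cn R n -> C) (z : Cn R n) : Cn R n :=
  \row_j (z ord0 j + if T j then G j z else 0).

(** A shear moves only the coordinates in [T], by amounts that only depend on
    the other ones; subtracting the same amounts therefore undoes it. *)
Lemma shear_biholomorphic n (T : pred 'I_n) (G : 'I_n -> Cn R n -> C) dG :
  (forall j, entire (G j) (dG j)) ->
  (forall j (z z' : Cn R n), (forall i, ~~ T i -> z ord0 i = z' ord0 i) -> G j z = G j z') ->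
  biholomorphic (shear T G).
Proof.
move=> eG indep; pose G' j z := (-1) * G j z.
have G0 (H : 'I_n -> Cn R n -> C) (z : Cn R n) i :
    ~~ T i -> z ord0 i = shear T H z ord0 i.
  by move=> /negPf Ti; rewrite mxE Ti addr0.
have hol H dH : (forall j, entire (H j) (dH j)) -> holomorphic (shear T H).
  move=> eH.
  pose E j (z : Cn R n) (i : 'I_n) : C := if T j then dH j z i else 0.
  apply: (@entire_holomorphic _ _ _ (fun j z i => (if i == j then 1 else 0) + E j z i)) => j.
  have -> : (fun z => shear T H z ord0 j) =
      (fun z => 1 * z ord0 j + (if T j then H j z else 0)).
    by apply/funext => z; rewrite mxE mul1r.
  apply: entireD; first exact: entire_coord.
  rewrite /E; case: (T j); [exact: eH|exact: entire_cst].
have eG' j : entire (G' j) (fun z i => (-1) * dG j z i + G j z * 0).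
  by apply: entireM => //; exact: entire_cst.
exists (shear T G'); split; [| |exact: hol eG|exact: hol eG'].
- move=> z; apply/rowP => j; rewrite mxE [shear T G z ord0 j]mxE.
  case: ifP => _; last by rewrite !addr0.
  by rewrite /G' -(indep j z)// ?mulN1r ?addrK//; exact: G0.
- move=> z; apply/rowP => j; rewrite mxE [shear T G' z ord0 j]mxE.
  case: ifP => _; last by rewrite !addr0.
  by rewrite -(indep j z)// /G' ?mulN1r ?subrK//; exact: G0.
Qed.

End Holomorphy.

(** * Interpolation by entire functions *)

Section Interpolation.
Variables (R : realType) (n : nat) (S : pred 'I_n).
Local Notation C := (Cfield R).

Definition depends_on (f : Cn R n -> C) :=
  forall z z' : Cn R n, (forall i, S i -> z ord0 i = z' ord0 i) -> f z = f z'.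

Lemma entire_separator (p : nat -> Cn R n) (k m : nat) :
  (forall j, (j < m)%N -> exists2 i, S i & p j ord0 i != p k ord0 i) ->
  exists A dA, [/\ entire A dA, depends_on A,
    forall j, (j < m)%N -> A (p j) = 0 & A (p k) = 1].
Proof.
elim: m => [_|m IH sep].
  by exists (fun=> 1), (fun _ _ => 0); split=> //; exact: entire_cst.
have [j jm|A [dA [eA SA A0 A1]]] := IH; first by apply: sep; exact: ltnW.
have [i Si neq] := sep m (ltnSn m).
pose a := (p k ord0 i - p m ord0 i)^-1.
have ne0 : p k ord0 i - p m ord0 i != 0 by rewrite subr_eq0 eq_sym.
have eL := entireD (entire_coord a i) (entire_cst n (- a * p m ord0 i)).
exists (fun z => A z * (a * z ord0 i + - a * p m ord0 i)); eexists; split.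
- exact: entireM eA eL.
- by move=> z z' h; rewrite (SA z z')// h.
- move=> j; rewrite ltnS leq_eqVlt => /orP[/eqP ->|jm]; last by rewrite A0// mul0r.
  by rewrite mulNr subrr mulr0.
- by rewrite A1 mul1r mulNr -mulrBr mulVf.
Qed.

(** The separator is damped by a high power of [z_i / (p k)_i], where [i] is the
    coordinate of [p k] of largest modulus. This monomial is [1] at [p k]; on
    the polydisc of radius [|(p k)_i| / 8] it has modulus at most [1/8], and its
    Lipschitz constant is also at most [1/8] once [|(p k)_i| >= 8]. By
    [qbound_exp] its [N]-th power then has bound [(3/8)^N], which beats any
    factor coming from the separator. *)
Lemma entire_bump (p : nat -> Cn R n) (k : nat) (l : C) (i0 : 'I_n) : S i0 ->
  (forall j, (j < k)%N -> exists2 i, S i & p j ord0 i != p k ord0 i) ->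
  exists f df, [/\ entire f df, depends_on f,
    forall j, (j < k)%N -> f (p j) = 0, f (p k) = l &
    forall i, S i -> 8 <= cmod (p k ord0 i) ->
      qbound (cmod (p k ord0 i) / 8) (2^-1 ^+ k) f df].
Proof.
move=> Si0 /entire_separator[A [dA [eA SA A0 A1]]].
have eB := entireM (entire_cst n l) eA.
case: (arg_maxP (fun i => cmod (p k ord0 i)) Si0) => i Si imax.
have [small|big] := ltP (cmod (p k ord0 i)) 8.
  exists (fun z => l * A z); eexists; split; first exact: eB.
  - by move=> z z' h; rewrite (SA z z').
  - by move=> j /A0 ->; rewrite mulr0.
  - by rewrite A1 mulr1.
  - by move=> j /imax h1; rewrite leNgt (le_lt_trans h1 small).
set a := p k ord0 i in imax big.
have a0 : a != 0 by rewrite -cmod_eq0; apply/eqP; lra.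
set r := cmod a / 8.
have [M hM] := eB r; have M0 := qb_ge0 hM.
have hL : qbound r (8^-1) (fun z : Cn R n => a^-1 * z ord0 i)
    (fun _ j => if j == i then a^-1 else 0).
  apply: qbound_coord; first by rewrite invr_ge0.
    by rewrite cmodV lef_pV2// posrE; lra.
  by rewrite cmodV /r mulrA mulVf ?mul1r// cmod_eq0.
have c0 : 0 < 2^-1 ^+ k / (3 * M + 1) by apply: divr_gt0; [apply: exprn_gt0|]; lra.
have [N /(_ N (leqnn N)) HN] := geo_gt c0.
have [d [ed hd]] := qbound_exp (entire_coord a^-1 i) hL N.
exists (fun z => (l * A z) * (a^-1 * z ord0 i) ^+ N); eexists; split.
- exact: entireM eB ed.
- by move=> z z' h; rewrite (SA z z')// h.
- by move=> j /A0 ->; rewrite mulr0 mul0r.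
- by rewrite A1 mulr1 mulVf// expr1n mulr1.
move=> j Sj _; apply: qbound_le (qboundM hM hd).
  by rewrite /r ler_pM2r//; exact: imax.
have le_geo : (3 / 8) ^+ N <= 2^-1 ^+ N :> R by apply: lerXn2r; rewrite ?nnegrE; lra.
apply: le_trans (_ : 3 * M * (2^-1 ^+ k / (3 * M + 1)) <= _).
  by rewrite ler_wpM2l ?mulr_ge0// (le_trans le_geo).
rewrite mulrCA ler_piMr ?exprn_ge0//.
by rewrite ler_pdivrMr; lra.
Qed.

(** Newton-style interpolation: the [k]-th term corrects the value at [p k]
    without touching the earlier points, and is small on large polydiscs. *)
Lemma entire_interpolation (p : nat -> Cn R n) (c : nat -> C) (i0 : 'I_n) : S i0 ->
  (forall j k, (forall i, S i -> p j ord0 i = p k ord0 i) -> j = k) ->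
  (forall r, exists K : nat, forall k, (K <= k)%N ->
     exists2 i, S i & r <= cmod (p k ord0 i)) ->
  exists f df, [/\ entire f df, depends_on f & forall k, f (p k) = c k].
Proof.
move=> Si0 inj prop.
have sep k j : (j < k)%N -> exists2 i, S i & p j ord0 i != p k ord0 i.
  move=> jk; apply: contrapT => nex; move: jk; rewrite (inj j k) ?ltnn// => i Si.
  by apply/eqP/negPn/negP => ne; apply: nex; exists i.
have [B hB] := choice (fun kl => entire_bump kl.2 Si0 (sep kl.1)).
have {hB} [dB hB] := choice hB.
pose F := fix F (k : nat) (z : Cn R n) : C := if k is k'.+1 then F k' z + B (k', c k' - F k' (p k')) z else 0.
pose T k := B (k, c k - F k (p k)); pose dT k := dB (k, c k - F k (p k)).
have sumT k z : \sum_(j < k) T j z = F k z.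
  by elim: k => [|k IH]; [rewrite big_ord0|rewrite big_ord_recr IH].
have [k|r|f [df [ef Tf]]] := @entire_series _ _ T dT.
- by have [] := hB (k, c k - F k (p k)).
- have [K HK] := prop (Num.max 8 (8 * r)).
  exists K => k /HK[i Si]; rewrite ge_max => /andP[h8 hr].
  have [_ _ _ _ /(_ i Si h8)] := hB (k, c k - F k (p k)).
  by apply: qbound_le => //=; rewrite ler_pdivlMr// mulrC.
exists f, df; split=> // [z z' h|k].
  have Fz k : F k z = F k z'.
    elim: k => //= k ->; congr (_ + _).
    by have [_ SB _ _ _] := hB (k, c k - F k (p k)); exact: SB.
  apply: (tends_unique (Tf z)); under [X in tends X _]funext do rewrite sumT Fz -sumT.
  exact: Tf.
apply: (tends_unique (Tf (p k))) => e e0; exists k.+1 => m km; rewrite sumT.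
suff -> : F m (p k) = c k by rewrite subrr cmod0 ltW.
rewrite -(subnKC km); elim: (m - k.+1)%N => [|d IH].
  rewrite addn0 /=; have [_ _ _ -> _] := hB (k, c k - F k (p k)).
  by rewrite addrC subrK.
rewrite addnS; move: IH (leq_addr d k.+1); set j := (k.+1 + d)%N => /= -> kj.
by have [_ _ /(_ k kj) /= -> _ _] := hB (j, c j - F j (p j)); rewrite addr0.
Qed.

End Interpolation.

(** * Almost every point avoids almost all boxes *)

Section GenericPoint.
Variable R : realType.

Lemma nneseries_term_small (a : nat -> R) (e : R) : (forall k, 0 <= a k) ->
  (\sum_(0 <= k <oo) (a k)%:E < +oo)%E -> 0 < e ->
  exists K : nat, forall k, (K <= k)%N -> a k < e.
Proof.
move=> a0 afin e0.
have aE k : (0 <= (a k)%:E)%E by rewrite lee_fin.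
have [K _ HK] : \forall N \near \oo, (\sum_(N <= k <oo) (a k)%:E < e%:E)%E.
  have /= tail := @nneseries_tail_cvg R (fun k => (a k)%:E) xpredT afin (fun k _ => aE k).
  apply: (tail [set y | (y < e%:E)%E]).
  by apply: open_nbhs_nbhs; split; [exact: open_ereal_lt_ereal|rewrite /= lte_fin].
exists K => k /HK /= /(le_lt_trans _); rewrite -lte_fin; apply.
have := @nneseries_lim_ge R (fun k => (a k)%:E) xpredT k k.+1 (fun n _ _ => aE n).
by rewrite big_nat1.
Qed.

(** Integrating in [x], the interval around [u k] contributes [b k] times its
    length [2 * r * rho k], so the series of indicators has a finite integral
    and is finite almost everywhere. *)
Lemma ae_section_summable (u rho b : nat -> R) (r : nat) :
  (forall k, 0 <= rho k) -> (forall k, 0 <= b k) ->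
  (\sum_(0 <= k <oo) (b k * rho k)%:E < +oo)%E ->
  {ae lebesgue_measure, forall x : R,
    (\sum_(0 <= k <oo) (b k * (`|u k - x| <= r%:R * rho k)%R%:R)%:E < +oo)%E}.
Proof.
move=> rho0 b0 bfin; pose mu := @lebesgue_measure R.
pose A k : set R := [set` `[u k - r%:R * rho k, u k + r%:R * rho k]].
have mA k : measurable (A k) by exact: measurable_itv.
have indE k x : (`|u k - x| <= r%:R * rho k)%R%:R = \1_(A k) x :> R.
  rewrite indicE /A mem_setE /= in_itv /= distrC ler_distl; congr (_%:R).
have m1 k : measurable_fun [set: R] (EFin \o \1_(A k)).
  by apply/measurable_EFinP; exact: measurable_indic.
pose g k x : \bar R := ((b k)%:E * (EFin \o \1_(A k)) x)%E.
have g0 k x : (0 <= g k x)%E by rewrite mule_ge0 ?lee_fin.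
have mg k : measurable_fun [set: R] (g k) by exact: measurable_funeM.
pose G x := (\sum_(0 <= k <oo) g k x)%E.
have GE x : (\sum_(0 <= k <oo) (b k * (`|u k - x| <= r%:R * rho k)%R%:R)%:E)%E = G x.
  by apply: eq_eseriesr => k _; rewrite indE EFinM.
have G0 x : (0 <= G x)%E by exact: nneseries_ge0.
have mG : measurable_fun [set: R] G by exact: ge0_emeasurable_sum.
have intg k : (\int[mu]_x g k x = (2 * r%:R)%:E * (b k * rho k)%:E)%E.
  rewrite ge0_integralZl_EFin//; [|by move=> x _; rewrite lee_fin|exact: m1].
  rewrite (_ : \int[mu]_x _ = mu (A k))%E; last first.
    by rewrite (integral_indic mu measurableT (mA k)) setIT.
  have -> : mu (A k) = (2 * r%:R * rho k)%:E.
    rewrite /mu /A lebesgue_measure_itv /= lte_fin; have := rho0 k => rk.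
    have : 0 <= r%:R * rho k by exact: mulr_ge0.
    rewrite le_eqVlt => /predU1P[h|h].
      by rewrite -mulrA -h subr0 addr0 ltxx mulr0.
    by rewrite ltrBlDr -addrA ltrDl addr_gt0// -EFinD; congr (_%:E); ring.
  by rewrite -EFinM -EFinM; congr (_%:E); ring.
have Gint : mu.-integrable [set: R] G.
  apply/integrableP; split=> //.
  under eq_integral do rewrite gee0_abs//.
  rewrite integral_nneseries//; under eq_eseriesr do rewrite intg.
  rewrite nneseriesZl; last by move=> k _; rewrite lee_fin mulr_ge0.
  by rewrite lte_mul_pinfty// lee_fin mulr_ge0.
apply: filterS (integrable_ae measurableT Gint) => x /(_ I).
by rewrite GE ge0_fin_numE.
Qed.

Lemma exists_section_summable (Bad : set R) (u rho : nat -> R) (b : nat -> nat -> R) :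
  countable Bad -> (forall k, 0 <= rho k) -> (forall r k, 0 <= b r k) ->
  (forall r, (\sum_(0 <= k <oo) (b r k * rho k)%:E < +oo)%E) ->
  exists x, [/\ 0 <= x <= 1, ~ Bad x &
    forall r : nat,
      (\sum_(0 <= k <oo) (b r k * (`|u k - x| <= r%:R * rho k)%R%:R)%:E < +oo)%E].
Proof.
move=> cBad rho0 b0 bfin.
have [N [mN N0 sN]] := ae_foralln (fun r => ae_section_summable u r rho0 (b0 r) (bfin r)).
have mBad : measurable Bad by exact: countable_measurable.
apply: contrapT => none.
have cover : `[0%R, 1%R]%classic `<=` N `|` Bad.
  move=> x /=; rewrite in_itv /= => x01.
  have [xB|xB] := pselect (Bad x); [by right|left; apply: sN => /= xgood].
  by apply: none; exists x.
have := le_measure lebesgue_measure _ _ cover; rewrite !inE.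
move=> /(_ (measurable_itv _) (measurableU _ _ mN mBad)).
rewrite [leLHS]lebesgue_measure_itv /= lte01 sube0 leNgt => /negP; apply.
apply: le_lt_trans (measureU2 _ mN mBad) _.
rewrite [X in (X + _)%E](_ : _ = 0%E) ?add0e; last exact: N0.
by rewrite [X in (X < _)%E](_ : _ = 0%E) ?lte01//; exact: countable_lebesgue_measure0.
Qed.

(** A product of intervals is handled one coordinate at a time: choosing [x m]
    generically trades one factor [rho k] of the weights for the restriction to
    those [k] whose last interval contains [x m]. *)
Lemma generic_point_weighted (Bad : set R) (rho : nat -> R) (m : nat)
    (u : nat -> nat -> R) (b : nat -> nat -> bool) :
  countable Bad -> (forall k, 0 <= rho k) ->
  (forall r, (\sum_(0 <= k <oo) ((b r k)%:R * rho k ^+ m)%:E < +oo)%E) ->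
  exists x : nat -> R, [/\ forall i, 0 <= x i <= 1, forall i, (i < m)%N -> ~ Bad (x i) &
    forall r : nat, exists K : nat, forall k, (K <= k)%N -> b r k ->
      exists2 i, (i < m)%N & r%:R * rho k < `|u k i - x i|].
Proof.
move=> cBad rho0; elim: m b => [|m IH] b bfin.
  exists (fun=> 0); split=> // [i|r]; first by rewrite lexx ler01.
  have [k|K HK] := @nneseries_term_small (fun k => (b r k)%:R * rho k ^+ 0) 1 _ (bfin r) ltr01.
    by rewrite mulr1.
  by exists K => k /HK; rewrite mulr1; case: (b r k) => //; rewrite ltxx.
have [r k|r|x [x01 xBad xfin]] := @exists_section_summable Bad (u^~ m) rho
    (fun r k => (b r k)%:R * rho k ^+ m) cBad rho0.
- by rewrite mulr_ge0// exprn_ge0.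
- by under eq_eseriesr do rewrite -mulrA -exprSr; exact: bfin.
have [r|y [y01 yBad yfin]] := IH (fun r k => b r k && (`|u k m - x| <= r%:R * rho k)).
  by under eq_eseriesr do rewrite -mulnb natrM mulrAC; exact: xfin.
exists (fun i => if i == m then x else y i); split=> [i|i|r].
- by case: eqP.
- by rewrite ltnS leq_eqVlt; case: eqP => //= _; exact: yBad.
have [K HK] := yfin r; exists K => k Kk bk.
have [le|lt] := leP `|u k m - x| (r%:R * rho k); last by exists m; rewrite ?eqxx.
have [|i im hi] := HK k Kk; first by rewrite bk.
by exists i; [exact: ltnW|rewrite ltn_eqF].
Qed.

Lemma generic_point (Bad : set R) (rho : nat -> R) (m : nat) (u : nat -> nat -> R) :
  countable Bad -> (forall k, 0 <= rho k) ->
  (\sum_(0 <= k <oo) (rho k ^+ m)%:E < +oo)%E ->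
  exists x : nat -> R, [/\ forall i, 0 <= x i <= 1, forall i, (i < m)%N -> ~ Bad (x i) &
    forall r : nat, exists K : nat, forall k, (K <= k)%N ->
      exists2 i, (i < m)%N & r%:R * rho k < `|u k i - x i|].
Proof.
move=> cBad rho0 fin.
have [r|x [x01 xBad hx]] := @generic_point_weighted Bad rho m u (fun _ _ => true) cBad rho0.
  by under eq_eseriesr do rewrite mul1r.
by exists x; split=> // r; have [K HK] := hx r; exists K => k /HK; exact.
Qed.

End GenericPoint.

(** * A generic projection is proper and injective on the points *)

Section GenericShear.
Variables (R : realType) (m : nat).
Local Notation C := (Cfield R).
Local Notation n := m.+2.

Definition off_axis : pred 'I_n := fun j => (j : nat) != 0%N.

Lemma off_axisPn (j : 'I_n) : ~~ off_axis j -> j = ord0.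
Proof. by rewrite negbK => /eqP h; apply: val_inj. Qed.

Lemma hnorm_le_sum (z : Cn R n) : hnorm z <= \sum_i cmod (z ord0 i).
Proof.
have sum0 (r : seq 'I_n) : 0 <= \sum_(i <- r) cmod (z ord0 i).
  by apply: sumr_ge0 => i _; exact: cmod_ge0.
rewrite /hnorm -[leRHS]ger0_norm// -sqrtr_sqr; apply: ler_wsqrtr.
have sqE i : complex.Re (z ord0 i) ^+ 2 + complex.Im (z ord0 i) ^+ 2 = cmod (z ord0 i) ^+ 2.
  by rewrite /cmod normc_def /= sqr_sqrtr// addr_ge0// sqr_ge0.
under eq_bigr do rewrite sqE.
elim: (index_enum _) => [|i r IH]; first by rewrite !big_nil expr0n.
rewrite !big_cons sqrrD addrAC; apply: le_trans (lerD (lexx _) IH) _.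
by rewrite lerDl mulrn_wge0// mulr_ge0// cmod_ge0.
Qed.

Definition slope (a : 'I_n -> C) (j : 'I_n) (z : Cn R n) : C := - a j * z ord0 ord0.

(** The kernel of the projection [z |-> (z_j - a_j z_0)_j] is spanned by
    [(1, a)]. The [k]-th point is projected into the polydisc of radius [r] only
    if [a] lies within [r / |v_k0|] of [v_k / v_k0] and, for large [v_k], only if
    [|v_k0|] is comparable to [|v_k|]. These [a] form a set of measure of order
    [|v_k|^(2 - 2n)], so a generic [a] sees only finitely many such [k].
    When two points have the same projection and differ, [a] is the slope of the
    line through them, and there are countably many of those. *)
Lemma exists_proper_shear (v : nat -> Cn R n) :
  (\sum_(0 <= k <oo) ((hnorm (v k) ^+ (2 * n - 2))%:E)^-1 < +oo)%E ->
  exists a : 'I_n -> C, let q k := shear off_axis (slope a) (v k) in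
    (forall r, exists K : nat, forall k, (K <= k)%N ->
       exists2 i, off_axis i & r <= cmod (q k ord0 i)) /\
    (forall j k, (forall i, off_axis i -> q j ord0 i = q k ord0 i) -> v j = v k).
Proof.
move=> hv; pose N k := hnorm (v k); pose rho k := (N k)^-1.
have eE : (2 * n - 2 = m.+1 + m.+1)%N by rewrite mulnS addnC addnK mul2n addnn.
rewrite {}eE in hv; set e := (m.+1 + m.+1)%N in hv.
have N_ge0 k : 0 <= N k by exact: sqrtr_ge0.
have N_gt0 k : 0 < N k.
  rewrite lt_neqAle N_ge0 andbT eq_sym; apply/eqP => Nk0; move: hv.
  rewrite (@nneseries_pinfty _ _ _ k) ?ltxx// => [j _|].
    by rewrite inve_ge0 lee_fin exprn_ge0//; exact: N_ge0.
  by rewrite -/(N k) Nk0 expr0n inve0.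
have rho_gt0 k : 0 < rho k by rewrite invr_gt0.
have {}hv : (\sum_(0 <= k <oo) (rho k ^+ e)%:E < +oo)%E.
  move: hv; congr (_ < _)%E; apply: eq_eseriesr => k _.
  by rewrite inver expf_eq0 gt_eqF ?N_gt0// andbF /rho exprVn.
pose w k := v k ord0 ord0; pose zeta k j := v k ord0 j / w k.
pose i1 : 'I_n := Ordinal (isT : (1 < n)%N).
(* Real parts of the first slope of the lines joining two of the points. *)
pose Bad := range (fun jk : nat * nat =>
  complex.Re ((v jk.1 ord0 i1 - v jk.2 ord0 i1) / (w jk.1 - w jk.2))).
(* The first [m.+1] real coordinates of the parameter are real parts, the others
   imaginary parts; coordinate [0] of [C^n] has no slope, whence the shift. *)
pose u k i := if (i < m.+1)%N then complex.Re (zeta k (inord i.+1))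
              else complex.Im (zeta k (inord (i - m.+1).+1)).
have cBad : countable Bad by apply: card_le_trans (card_image_le _ _) (countableP _).
have [x [x01 xBad xprop]] := generic_point u cBad (fun k => ltW (rho_gt0 k)) hv.
pose a (j : 'I_n) : C := (x j.-1 +i* x (m.+1 + j.-1)%N)%C.
have a2 j : cmod (a j) <= 2.
  apply: le_trans (cmod_ReIm _) _ => /=.
  have /andP[p1 p2] := x01 j.-1; have /andP[p3 p4] := x01 (m.+1 + j.-1)%N.
  by rewrite !ger0_norm//; lra.
have qE k j : off_axis j -> shear off_axis (slope a) (v k) ord0 j =
    v k ord0 j - a j * w k.
  by move=> jS; rewrite mxE jS /slope mulNr.
have far (r k : nat) : (exists2 i, (i < e)%N & r%:R * rho k < `|u k i - x i|) ->
    exists2 j, off_axis j & r%:R * rho k < cmod (zeta k j - a j).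
  move=> [i ie]; rewrite /u; case: ltnP => im hi.
    have jE : (inord i.+1 : 'I_n) = i.+1 :> nat by rewrite inordK.
    exists (inord i.+1); first by rewrite /off_axis jE.
    apply: lt_le_trans hi _; apply: le_trans (cmod_Re _).
    by rewrite raddfB /= jE.
  have ijm : ((i - m.+1) < m.+1)%N by rewrite ltn_subLR.
  have jE : (inord (i - m.+1).+1 : 'I_n) = (i - m.+1).+1 :> nat by rewrite inordK.
  exists (inord (i - m.+1).+1); first by rewrite /off_axis jE.
  apply: lt_le_trans hi _; apply: le_trans (cmod_Im _).
  by rewrite raddfB /= jE /= subnKC.
exists a; split=> [r|j k h]; last first.
  have [wjk|wjk] := eqVneq (w j) (w k).
    apply/rowP => i; have [iS|/off_axisPn ->] := boolP (off_axis i); last exact: wjk.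
    by have := h i iS; rewrite !qE// wjk => /addIr.
  case: (xBad 0%N isT); exists (j, k) => //=.
  have := h i1 isT; rewrite !qE// => /eqP; rewrite subr_eq addrAC eq_sym subr_eq.
  move=> /eqP E; rewrite (_ : _ / _ = a i1)//.
  apply: canLR (mulfK _) _; first by rewrite subr_eq0.
  by rewrite mulrBr; apply/eqP; rewrite subr_eq addrAC eq_sym subr_eq -E addrC.
pose n' : R := n%:R; have n'1 : 1 <= n' by rewrite ler1n.
pose M := (Num.truncn (4 * n' * r)).+1.
have rM : 4 * n' * r < M%:R by rewrite truncnS_gt.
(* Beyond [K2] one has [|v_k| > 2 n r]: then a projection of modulus below [r]
   forces [|v_k0|] to be at least [|v_k| / (4 n)], and [M] is chosen for the
   parameter to be at distance at least [4 n r / |v_k|] from [v_k / v_k0]. *)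
pose d := (2 * n' * `|r| + 1)^-1.
have d0 : 0 < d by rewrite invr_gt0 ltr_wpDl// !mulr_ge0//; lra.
have [K1 HK1] := xprop M.
have [k|K2 HK2] := @nneseries_term_small R _ (d ^+ e) _ hv (exprn_gt0 _ d0).
  by rewrite exprn_ge0// ltW.
exists (maxn K1 K2) => k; rewrite geq_max => /andP[/HK1/far[j jS far_j] /HK2 rho_small].
apply: contrapT => nex.
have close i : off_axis i -> cmod (v k ord0 i - a i * w k) < r.
  by move=> iS; rewrite -qE// ltNge; apply/negP => ri; apply: nex; exists i.
have r0 : 0 < r by apply: le_lt_trans (close i1 isT); exact: cmod_ge0.
have w0 := cmod_ge0 (w k).
have coordle i : cmod (v k ord0 i) <= r + 2 * cmod (w k).
  have [iS|/off_axisPn ->] := boolP (off_axis i); last by rewrite -/(w k); lra.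
  have := cmodD (v k ord0 i - a i * w k) (a i * w k); rewrite subrK cmodM.
  have := close i iS; have : cmod (a i) * cmod (w k) <= 2 * cmod (w k) by rewrite ler_wpM2r.
  lra.
have Nle : N k <= n' * (r + 2 * cmod (w k)).
  apply: le_trans (hnorm_le_sum _) _.
  apply: le_trans (ler_sum _ (fun i _ => coordle i)) _.
  by rewrite sumr_const card_ord [leRHS]mulr_natl.
have Nbig : 2 * n' * r < N k.
  rewrite ltNge; apply/negP => Nsmall.
  move: rho_small; rewrite ltNge => /negP; apply.
  apply: lerXn2r; [exact: ltW|exact: ltW|].
  rewrite /d /rho lef_pV2 ?posrE ?N_gt0//; last by rewrite -invr_gt0.
  by rewrite gtr0_norm//; lra.
have wbig : N k < 4 * n' * cmod (w k) by lra.
have wne : cmod (w k) != 0.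
  by apply/eqP => w00; move: wbig; rewrite w00 mulr0; have := N_gt0 k; lra.
have := close j jS; rewrite ltNge => /negP; apply.
have -> : v k ord0 j - a j * w k = (zeta k j - a j) * w k.
  by rewrite mulrBl /zeta divfK// -cmod_eq0.
rewrite cmodM; apply: le_trans (_ : M%:R * rho k * cmod (w k) <= _); last first.
  by rewrite ler_wpM2r// ltW.
rewrite mulrAC /rho ler_pdivlMr//.
apply: le_trans (_ : r * (4 * n' * cmod (w k)) <= _).
  by rewrite ler_wpM2l// ltW.
have -> : r * (4 * n' * cmod (w k)) = 4 * n' * r * cmod (w k) by ring.
by rewrite ler_wpM2r// ltW.
Qed.

End GenericShear.

(** * Moving the points onto the integer axis *)

Section Enumeration.

Lemma inj_nat_proper (s : nat -> nat) (K : nat) :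
  injective s -> exists L : nat, forall k, (L <= k)%N -> (K <= s k)%N.
Proof.
move=> s_inj; elim: K => [|K [L HL]]; first by exists 0%N.
have [[k0 sk0]|none] := pselect (exists k0, s k0 = K).
  exists (maxn L k0.+1) => k; rewrite geq_max => /andP[Lk k0k].
  rewrite ltn_neqAle HL// andbT; apply/eqP => Ksk.
  by move: k0k; rewrite (s_inj k0 k) ?ltnn// sk0.
exists L => k Lk; rewrite ltn_neqAle HL// andbT; apply/eqP => Ksk.
by apply: none; exists k.
Qed.

Definition nat_to_int (k : nat) : int := if odd k then Negz k./2 else Posz k./2.

Lemma nat_to_int_inj : injective nat_to_int.
Proof.
move=> j k jk; rewrite -(odd_double_half j) -(odd_double_half k); move: jk.
by rewrite /nat_to_int; case: (odd j); case: (odd k) => // -[->].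
Qed.

Lemma nat_to_int_surj (z : int) : exists k, nat_to_int k = z.
Proof.
case: z => a; [exists a.*2|exists a.*2.+1]; rewrite /nat_to_int /= odd_double/=.
  by rewrite doubleK.
by rewrite uphalf_double.
Qed.

Lemma nat_to_int_proper (R : realType) (r : R) : exists K : nat, forall k, (K <= k)%N ->
  r <= cmod ((nat_to_int k)%:~R : Cfield R).
Proof.
pose T := (Num.truncn r).+1.
have rT : r < T%:R by rewrite truncnS_gt.
exists T.*2 => k Tk; have Tk2 : (T <= k./2)%N by rewrite -(doubleK T) half_leq.
apply: le_trans (ltW rT) _.
have -> : ((nat_to_int k)%:~R : Cfield R) = ((nat_to_int k)%:~R : R)%:C%C.
  by rewrite rmorph_int.
rewrite cmod_real -intr_norm /nat_to_int; case: (odd k).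
  by rewrite NegzE normrN ger0_norm// -pmulrn ler_nat ltnW.
by rewrite ger0_norm// -pmulrn ler_nat.
Qed.

End Enumeration.

(** The three shears alternate between the zeroth coordinate and the others:
    each uses as interpolation nodes the coordinates that the previous one has
    put in good position and that it leaves unchanged. *)
Theorem tame_of_proper (R : realType) (m : nat) (p : nat -> Cn R m.+2)
    (a : 'I_m.+2 -> Cfield R) :
  let q k := shear (@off_axis m) (slope a) (p k) in
  (forall r, exists K : nat, forall k, (K <= k)%N ->
     exists2 i, off_axis i & r <= cmod (q k ord0 i)) ->
  (forall j k, (forall i, off_axis i -> q j ord0 i = q k ord0 i) -> j = k) ->
  tame (range p).
Proof.
move=> q q_proper q_inj.
pose i1 : 'I_m.+2 := Ordinal (isT : (1 < m.+2)%N).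
pose e k : Cfield R := (nat_to_int k)%:~R.
have [f [df [ef f_dep fq]]] := @entire_interpolation _ _ (@off_axis m) q
  (fun k => e k - q k ord0 ord0) i1 isT q_inj q_proper.
pose on_axis (j : 'I_m.+2) := ~~ off_axis j.
pose p2 k := shear on_axis (fun=> f) (q k).
have p2_axis k : p2 k ord0 ord0 = e k.
  by rewrite mxE /= fq addrC subrK.
have axis0 : on_axis ord0 by [].
have e_inj j k : (forall i, on_axis i -> p2 j ord0 i = p2 k ord0 i) -> j = k.
  move=> /(_ ord0 axis0); rewrite !p2_axis /e => /eqP; rewrite eqr_int => /eqP.
  exact: nat_to_int_inj.
have e_proper r : exists K : nat, forall k, (K <= k)%N ->
    exists2 i, on_axis i & r <= cmod (p2 k ord0 i).
  have [K HK] := nat_to_int_proper r.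
  by exists K => k Kk; exists ord0; rewrite // p2_axis HK.
have /choice[g /choice[dg hg]] : forall j, exists g dg, [/\ entire g dg,
    depends_on on_axis g & forall k, g (p2 k) = - p2 k ord0 j].
  by move=> j; exact: entire_interpolation axis0 e_inj e_proper.
have eg j : entire (g j) (dg j) by have [] := hg j.
have g_dep j : depends_on on_axis (g j) by have [] := hg j.
have gp j k : g j (p2 k) = - p2 k ord0 j by have [_ _] := hg j.
pose phi1 : Cn R m.+2 -> Cn R m.+2 := shear (@off_axis m) (slope a).
pose phi2 : Cn R m.+2 -> Cn R m.+2 := shear on_axis (fun=> f).
pose phi3 : Cn R m.+2 -> Cn R m.+2 := shear (@off_axis m) g.
have phi3p2 k : phi3 (p2 k) =
    \row_(j < m.+2) (if j == 0 :> nat then (nat_to_int k)%:~R else 0).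
  apply/rowP => j; rewrite [LHS]mxE [RHS]mxE gp.
  have [jS|jS] := boolP (off_axis j); first by rewrite (negPf jS) subrr.
  by rewrite addr0 (off_axisPn jS) p2_axis.
exists (phi3 \o (phi2 \o phi1)); split.
  apply: biholomorphic_comp; first apply: biholomorphic_comp.
  - apply: shear_biholomorphic => [j|j z z' h]; first exact: entire_coord.
    by rewrite /slope (h ord0).
  - apply: shear_biholomorphic => [j|_ z z' h]; first exact: ef.
    by apply: f_dep => i iS; apply: h; rewrite negbK.
  - by apply: shear_biholomorphic eg _ => j z z' h; exact: g_dep.
rewrite image_comp; apply/seteqP; split=> [_ [k _ <-]|_ [z _ <-]] /=.
  by exists (nat_to_int k) => //; rewrite -phi3p2.
by have [k <-] := nat_to_int_surj z; exists k => //; rewrite -phi3p2.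
Qed.

Theorem theorem1 (R : realType) (n : nat) (hn : (2 <= n)%N) (v : nat -> Cn R n)
  (hv : (\sum_(0 <= k <oo) ((hnorm (v k) ^+ (2 * n - 2))%:E)^-1 < +oo)%E) :
  tame (range v).
Proof.
case: n hn v hv => [|[|m]] // _ v /exists_proper_shear[a [q_proper q_sep]].
(* A finite range would be bounded, although its projections tend to infinity. *)
have D_infinite : infinite_set (range v).
  move=> /finite_seqP[X rangeX].
  pose norm1 z := \sum_i cmod (shear (@off_axis m) (slope a) z ord0 i).
  have norm1_ge0 z : 0 <= norm1 z by apply: sumr_ge0 => i _; exact: cmod_ge0.
  have [K /(_ K (leqnn K))[i _]] := q_proper (\sum_(z <- X) norm1 z + 1).
  apply/negP; rewrite -ltNge ltr_pwDr//.
  have vX : v K \in X.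
    by have : range v (v K) by [exists K]; rewrite rangeX.
  rewrite (big_rem _ vX) /=; apply: ler_wpDr; first exact: sumr_ge0.
  by rewrite /norm1 (bigD1 i)//= lerDl sumr_ge0// => j _; exact: cmod_ge0.
have D_countable : countable (range v).
  exact: card_le_trans (card_image_le _ _) (countableP _).
have := eq_card_nat D_countable D_infinite; rewrite card_eq_sym.
move=> /card_set_bijP[p [pD p_inj p_surj]].
have -> : range v = range p.
  apply/seteqP; split=> z; last by move=> [k _ <-]; exact: pD.
  by move=> /p_surj[k _ <-]; exists k.
have /choice[s vs] : forall k, exists l, v l = p k.
  by move=> k; have [l _ <-] := pD k I; exists l.
have p_injective j k : p j = p k -> j = k by apply: p_inj; rewrite inE.
have s_inj : injective s by move=> j k sjk; apply: p_injective; rewrite -!vs sjk.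
apply: (@tame_of_proper _ _ p a) => [r|j k h].
  have [K HK] := q_proper r; have [L HL] := inj_nat_proper K s_inj.
  by exists L => k Lk; rewrite -vs; exact: HK (HL k Lk).
by apply: p_injective; rewrite -!vs; apply: q_sep; rewrite !vs.
Qed.
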